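(* If $R$ is a strongly $J^{\#}$-clean ring, then the quotient ring $R/J(R)$ is Boolean.
   Context: All rings are associative with identity, not necessarily commutative. $J(R)$ denotes the Jacobson radical of $R$ and $J^{\#}(R)=\{z\in R : z^n\in J(R)\text{ for some } n\ge 1\}$. A ring $R$ is strongly $J^{\#}$-clean if every $a\in R$ can be written $a=e+j$ with $e^2=e\in R$, $j\in J^{\#}(R)$ and $ej=je$. A ring is Boolean if every element is idempotent. *)

(* Defs.v *)
From HB Require Import structures.
From mathcomp Require Import all_boot all_order all_algebra.
From mathcomp Require Import boolp classical_sets.

Set Implicit Arguments.
Unset Strict Implicit.
Unset Printing Implicit Defensive.

Import GRing.Theory.

Local Open Scope ring_scope.
Local Open Scope classical_set_scope.
Local Open Scope quotient_scope.

(* Rings are [pzRingType]s, so that the zero ring is not excluded. *)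

Definition left_ideal (R : pzRingType) (I : set R) : Prop :=
  I 0 /\ forall a u v, I u -> I v -> I (a * u + v).

Definition maximal_left_ideal (R : pzRingType) (M : set R) : Prop :=
  [/\ left_ideal M, M <> setT &
      forall K : set R, left_ideal K -> M `<=` K -> K = M \/ K = setT].

(* Boolean-valued, so that it can carry the [zmodClosed] structure needed to
   form quotients. For the zero ring the intersection is empty and J(R) = R. *)
Definition jacobson (R : pzRingType) : {pred R} :=
  fun x => `[< (\bigcap_(M in @maximal_left_ideal R) M) x >].
Arguments jacobson : clear implicits.

Section JacobsonIdeal.
Variable R : pzRingType.
Implicit Types (I M : set R) (a x y : R).

Lemma left_ideal0 I : left_ideal I -> I 0.
Proof. by case. Qed.

Lemma left_idealD I x y : left_ideal I -> I x -> I y -> I (x + y).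
Proof. by case=> _ h Ix Iy; rewrite -[x]mul1r; apply: h. Qed.

Lemma left_idealMr I a x : left_ideal I -> I x -> I (a * x).
Proof. by case=> I0 h Ix; rewrite -[_ * _]addr0; apply: h. Qed.

Lemma left_idealB I x y : left_ideal I -> I x -> I y -> I (x - y).
Proof.
move=> idI Ix Iy; apply: left_idealD => //.
by rewrite -mulN1r; apply: left_idealMr.
Qed.

Lemma jacobsonP x :
  reflect (forall M, maximal_left_ideal M -> M x) (x \in jacobson R).
Proof. exact: asboolP. Qed.

Lemma jacobson_zmod_closed : zmod_closed (jacobson R).
Proof.
split=> [|x y /jacobsonP Jx /jacobsonP Jy]; apply/jacobsonP => M maxM.
  by case: (maxM) => idM _ _; apply: left_ideal0.
by case: (maxM) => idM _ _; apply: left_idealB => //; [apply: Jx|apply: Jy].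
Qed.

HB.instance Definition _ :=
  GRing.isZmodClosed.Build R (jacobson R) jacobson_zmod_closed.

Lemma jacobsonMl a x : x \in jacobson R -> a * x \in jacobson R.
Proof.
move=> /jacobsonP Jx; apply/jacobsonP => M maxM.
by case: (maxM) => idM _ _; apply: left_idealMr => //; apply: Jx.
Qed.

Lemma maximal_left_ideal_colon M a : maximal_left_ideal M -> ~ M a ->
  maximal_left_ideal [set x | M (x * a)].
Proof.
case=> idM _ maxM nMa; split.
- split=> [|b u v Mu Mv] /=; first by rewrite mul0r; apply: left_ideal0.
  rewrite mulrDl -mulrA; apply: left_idealD => //; exact: left_idealMr.
- by move=> E; apply: nMa; rewrite -[a]mul1r -[M _]/([set x | M (x * a)] 1) E.
move=> K idK sNK; have [sKN|] := pselect (K `<=` [set x | M (x * a)]).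
  by left; apply/seteqP.
move=> /existsNP[k /not_implyP[Kk /= nMka]]; right.
pose L : set R := [set z | exists m s, M m /\ z = m + s * (k * a)].
have idL : left_ideal L.
  split=> [|b _ _ [m [s [Mm ->]]] [m' [s' [Mm' ->]]]].
    by exists 0, 0; rewrite mul0r addr0; split=> //; apply: left_ideal0.
  exists (b * m + m'), (b * s + s'); split.
    by apply: left_idealD => //; apply: left_idealMr.
  by rewrite mulrDr [(_ + s') * _]mulrDl !mulrA addrACA.
have sML : M `<=` L by move=> m Mm; exists m, 0; rewrite mul0r addr0.
have Lka : L (k * a).
  by exists 0, 1; rewrite mul1r add0r; split=> //; apply: left_ideal0.
have LT : L = setT by case: (maxM L idL sML) => // E; case: nMka; rewrite -E.
apply/seteqP; split=> // x _.
have [m [s [Mm Exa]]] : L (x * a) by rewrite LT.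
rewrite -[x](subrK (s * k)); apply: left_idealD => //; last first.
  exact: left_idealMr.
by apply: sNK; rewrite /= mulrBl Exa -mulrA addrK.
Qed.

Lemma jacobsonMr a x : x \in jacobson R -> x * a \in jacobson R.
Proof.
move=> /jacobsonP Jx; apply/jacobsonP => M maxM.
have [Ma|nMa] := pselect (M a).
  by case: (maxM) => idM _ _; apply: left_idealMr.
exact: Jx (maximal_left_ideal_colon maxM nMa).
Qed.

End JacobsonIdeal.

Definition jacobson_quot (R : pzRingType) : Type :=
  Quotient.quot (jacobson R).

(* The library only equips [Quotient.quot] with a multiplication when the base
   ring is commutative and the ideal proper. *)
Section JacobsonQuotient.
Variable R : pzRingType.
Local Notation Q := (jacobson_quot R).

HB.instance Definition _ := GRing.Zmodule.on Q.
HB.instance Definition _ := EqQuotient.on Q.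
HB.instance Definition _ :=
  ZmodQuotient.copy Q (Quotient.quot (jacobson R)).

Definition jacobson_quot_one : Q := lift_cst Q 1.
Definition jacobson_quot_mul : Q -> Q -> Q := lift_op2 Q *%R.

Canonical pi_jacobson_quot_one := PiConst jacobson_quot_one.

Lemma pi_jacobson_quot_mul :
  {morph \pi_Q : x y / x * y >-> jacobson_quot_mul x y}.
Proof.
move=> x y; unlock jacobson_quot_mul; apply/eqP.
rewrite -Quotient.idealrBE.
rewrite -[x * y](subrK (x * repr (\pi_Q y))) -mulrBr -addrA -mulrBl rpredD //.
  by rewrite jacobsonMl // Quotient.idealrBE reprK.
by rewrite jacobsonMr // Quotient.idealrBE reprK.
Qed.
Canonical pi_jacobson_quot_mul_morph := PiMorph2 pi_jacobson_quot_mul.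

Lemma jacobson_quot_mulA : associative jacobson_quot_mul.
Proof. by move=> x y z; rewrite -[x]reprK -[y]reprK -[z]reprK !piE mulrA. Qed.

Lemma jacobson_quot_mul1l : left_id jacobson_quot_one jacobson_quot_mul.
Proof. by move=> x; rewrite -[x]reprK !piE mul1r. Qed.

Lemma jacobson_quot_mul1r : right_id jacobson_quot_one jacobson_quot_mul.
Proof. by move=> x; rewrite -[x]reprK !piE mulr1. Qed.

Lemma jacobson_quot_mulDl : left_distributive jacobson_quot_mul +%R.
Proof.
by move=> x y z; rewrite -[x]reprK -[y]reprK -[z]reprK !piE mulrDl.
Qed.

Lemma jacobson_quot_mulDr : right_distributive jacobson_quot_mul +%R.
Proof.
by move=> x y z; rewrite -[x]reprK -[y]reprK -[z]reprK !piE mulrDr.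
Qed.

HB.instance Definition _ := GRing.Zmodule_isPzRing.Build Q
  jacobson_quot_mulA jacobson_quot_mul1l jacobson_quot_mul1r
  jacobson_quot_mulDl jacobson_quot_mulDr.

Lemma pi_jacobson_quot_monoid_morphism : monoid_morphism \pi_Q.
Proof. by split=> [|x y]; rewrite !piE. Qed.

End JacobsonQuotient.

Definition Jsharp (R : pzRingType) : set R :=
  [set z | exists n : nat, (1 <= n)%N /\ z ^+ n \in jacobson R].

Definition strongly_Jsharp_clean (R : pzRingType) : Prop :=
  forall a : R, exists e j : R,
    [/\ a = e + j, e ^+ 2 = e, Jsharp j & e * j = j * e].

Definition boolean_ring (R : pzRingType) : Prop :=
  forall x : R, x ^+ 2 = x.

(* Main.v *)
Require Import Defs.
From mathcomp Require Import all_boot all_order all_algebra.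
From mathcomp Require Import boolp classical_sets.

(** In S = R/J(R) every element is the sum of an idempotent and a nilpotent
    that commute, so it is enough to show that S is reduced: the nilpotent
    parts then vanish and every element is idempotent.

    Squaring a decomposition shows that x ^+ 2 - x is nilpotent for every x in
    S ([sqrB_nilpotent]).  This rules out 2 x 2 matrix units: the Fibonacci
    matrix a with rows (1, 1) and (1, 0) satisfies a ^+ 2 - a = 1, which would
    be a nonzero nilpotent idempotent ([matrix_units_trivial]).  On the other
    hand, if b * b = 0 and r * b is not nilpotent, then the idempotent part of
    r * b is a nonzero left multiple of b, and it generates such matrix units
    together with b (Levitzki's construction).  Hence r * b is nilpotent for
    every r ([sqr0_mul_nilpotent]), and since a left ideal that is nil modulo
    J(R) lies in J(R) ([nil_left_ideal_jacobson]), b = 0 in S. *)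

Set Implicit Arguments.
Unset Strict Implicit.
Unset Printing Implicit Defensive.

Import GRing.Theory.

Local Open Scope ring_scope.
Local Open Scope quotient_scope.

Definition nilpotent (S : pzRingType) (x : S) : Prop := exists n, x ^+ n = 0.

Definition strongly_nil_clean (S : pzRingType) : Prop :=
  forall a : S, exists e j : S,
    [/\ a = e + j, e * e = e, nilpotent j & e * j = j * e].

Section Nilpotents.
Variable S : pzRingType.
Implicit Types x y : S.

Lemma nilpotentM_comm x y : GRing.comm x y -> nilpotent x -> nilpotent (x * y).
Proof. by move=> cxy [n xn0]; exists n; rewrite exprMn_comm // xn0 mul0r. Qed.

Lemma idempotent_nilpotent_eq0 x : x * x = x -> nilpotent x -> x = 0.
Proof.
move=> xx [n xn0]; have xS k : x ^+ k.+1 = x.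
  by elim: k => [|k IHk]; rewrite ?expr1 // exprS IHk.
by rewrite -(xS n) exprS xn0 mulr0.
Qed.

Lemma nilpotent_left_inverse x : nilpotent x -> exists w, w * (1 + x) = 1.
Proof.
case=> n xn0; exists (\sum_(i < n) (- x) ^+ i).
have cS : GRing.comm (1 + x) (\sum_(i < n) (- x) ^+ i).
  apply: commr_sum => i _; apply: commrX; apply: commrN.
  by apply: commr_sym; apply: commrD => //; apply: commr1.
rewrite -cS; apply: oppr_inj; rewrite -mulNr opprD [- 1 - x]addrC -subrX1.
by rewrite exprNn xn0 mulr0 sub0r.
Qed.

Lemma sqr0_reduced : (forall x, x * x = 0 -> x = 0) ->
  forall x, nilpotent x -> x = 0.
Proof.
move=> sqr0 x [n]; elim: n => [|[|n] IHn] xn0.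
- by rewrite -[x]mulr1 -(expr0 x) xn0 mulr0.
- by rewrite -[x]expr1.
apply: IHn; apply: sqr0.
by rewrite -exprD -addSnnS exprD xn0 mul0r.
Qed.

End Nilpotents.

Section StronglyNilClean.
Variable S : pzRingType.
Implicit Types a b e r t x : S.

Lemma sqrB_nilpotent : strongly_nil_clean S ->
  forall x, nilpotent (x * x - x).
Proof.
move=> cleanS x; have [e [j [-> ee nil_j ej]]] := cleanS x.
have -> : (e + j) * (e + j) - (e + j) = j * (e + e + j - 1).
  rewrite mulrDl !mulrDr ee ej mulrN mulr1 opprD.
  by rewrite -[e + _ + _]addrA [e + _]addrC addrA addrK !addrA.
apply: nilpotentM_comm => //.
by apply: commrB; [do 2?apply: commrD | apply: commr1].
Qed.

(** The relations are those of the matrix units e = e_11, b = e_21, t = e_12,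
    with b * t in the role of e_22. *)
Lemma matrix_units_trivial e b t : strongly_nil_clean S ->
  e * e = e -> e * b = 0 -> b * e = b -> t * e = 0 -> e * t = t ->
  b * b = 0 -> t * t = 0 -> t * b = e -> e = 0.
Proof.
move=> cleanS ee eb be te et bb tt tb.
have bte : b * t * e = 0 by rewrite -mulrA te mulr0.
have gg : (e + b * t) * (e + b * t) = e + b * t.
  rewrite mulrDl !mulrDr ee bte [e * (b * t)]mulrA eb mul0r addr0 add0r.
  by rewrite -mulrA [t * (b * t)]mulrA tb et.
have fibE : (e + b + t) * (e + b + t) - (e + b + t) = e + b * t.
  apply/eqP; rewrite subr_eq; apply/eqP.
  rewrite !mulrDl !mulrDr ee eb be te et bb tt tb !addr0 add0r.
  by rewrite -[RHS]addrA [b * t + _]addrC !addrA (ACl (5 * 1 * 3 * 2 * 4)%AC).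
suff g0 : e + b * t = 0 by rewrite -ee -[e * e]addr0 -bte -mulrDl g0 mul0r.
apply: idempotent_nilpotent_eq0 => //.
by rewrite -fibE; apply: sqrB_nilpotent.
Qed.

Lemma sqr0_mul_nilpotent b : strongly_nil_clean S -> b * b = 0 ->
  forall r, nilpotent (r * b).
Proof.
move=> cleanS bb r; have [e [j [rbE ee nil_j ej]]] := cleanS (r * b).
suff e0 : e = 0 by rewrite rbE e0 add0r.
have [w wj] := nilpotent_left_inverse nil_j.
(* e * (r * b) = e * (1 + j), so inverting 1 + j recovers e as a multiple of
   b; the outer factor e makes e * t = t. *)
pose t := e * (w * e * r).
have tb : t * b = e.
  rewrite /t -!mulrA rbE mulrDr ee ej.
  by rewrite -[X in w * (X + _)]mul1r -mulrDl !mulrA -[e * w * _]mulrA wj mulr1 ee.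
have et : e * t = t by rewrite /t mulrA ee.
have eb : e * b = 0 by rewrite -tb -mulrA bb mulr0.
(* t * e and b * (1 - e) need not vanish, hence the corners t * (1 - e) and
   b * e below. *)
have Ceb : (1 - e) * b = b by rewrite mulrBl mul1r eb subr0.
have Cee : (1 - e) * e = 0 by rewrite mulrBl mul1r ee subrr.
apply: (@matrix_units_trivial e (b * e) (t * (1 - e))) => //.
- by rewrite mulrA eb mul0r.
- by rewrite -mulrA ee.
- by rewrite -mulrA Cee mulr0.
- by rewrite mulrA et.
- by rewrite mulrA -[b * e * b]mulrA eb mulr0 mul0r.
- by rewrite mulrA -[t * _ * t]mulrA -et [(1 - e) * _]mulrA Cee mul0r mulr0 mul0r.
- by rewrite mulrA -[t * _ * b]mulrA Ceb tb ee.
Qed.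

End StronglyNilClean.

(** If b lies outside a maximal left ideal M, then 1 - r * b is in M for some
    r.  A power of r * b in J(R), hence in M, would then put 1 in M, because
    1 - r * b divides 1 - (r * b) ^+ n on the right. *)
Lemma nil_left_ideal_jacobson (R : pzRingType) (b : R) :
  (forall r, exists n, (r * b) ^+ n \in jacobson R) -> b \in jacobson R.
Proof.
move=> nil_b; apply/jacobsonP => M maxM; case: (maxM) => idM MT max.
have [//|nMb] := pselect (M b); case: MT.
pose K : set R := fun z => exists m r, M m /\ z = m + r * b.
have idK : left_ideal K.
  split=> [|a _ _ [m [r [Mm ->]]] [m' [r' [Mm' ->]]]].
    by exists 0, 0; rewrite mul0r addr0; split=> //; apply: left_ideal0.
  exists (a * m + m'), (a * r + r'); split; first by case: idM => _; apply.
  by rewrite mulrDr mulrDl !mulrA addrACA.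
have sMK : (M `<=` K)%classic.
  by move=> m Mm; exists m, 0; rewrite mul0r addr0.
have Kb : K b by exists 0, 1; rewrite mul1r add0r; split=> //; apply: left_ideal0.
have KT : K = setT by case: (max K idK sMK) => // KM; rewrite KM in Kb.
have [m [r [Mm oneE]]] : K 1 by rewrite KT.
have [n /jacobsonP/(_ M maxM) Mn] := nil_b r.
have M1 : M 1.
  rewrite -[1](subrK ((r * b) ^+ n)); apply: left_idealD => //.
  have mE : m = 1 - r * b by rewrite oneE addrK.
  have cS : GRing.comm (1 - r * b) (\sum_(i < n) (r * b) ^+ i).
    apply: commr_sum => i _; apply: commrX; apply: commr_sym.
    by apply: commrB => //; apply: commr1.
  rewrite -opprB subrX1 -mulNr opprB cS -mE.
  exact: left_idealMr.
by apply/seteqP; split=> // x _; rewrite -[x]mulr1; apply: left_idealMr.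
Qed.

Section Quotient.
Variable R : pzRingType.
Local Notation Q := (jacobson_quot R).
Implicit Type x : R.

Lemma pi_jacobson_quotX x n : \pi_Q (x ^+ n) = (\pi_Q x) ^+ n.
Proof.
have [pi1 piM] := pi_jacobson_quot_monoid_morphism R.
by elim: n => [|n IHn]; rewrite ?expr0 // !exprS piM IHn.
Qed.

Lemma pi_jacobson_quot_eq0 x : \pi_Q x = 0 <-> x \in jacobson R.
Proof.
have pi0 : \pi_Q 0 = 0 by rewrite piE.
by rewrite -[x in x \in _]subr0 Quotient.idealrBE pi0; split=> /eqP.
Qed.

Lemma jacobson_quot_strongly_nil_clean :
  strongly_Jsharp_clean R -> strongly_nil_clean Q.
Proof.
have [_ piM] := pi_jacobson_quot_monoid_morphism R.
move=> cleanR a; have [e [j [aE ee [n [_ Jjn]] ej]]] := cleanR (repr a).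
exists (\pi_Q e), (\pi_Q j); split.
- by rewrite -[a]reprK aE !piE.
- by rewrite -piM -expr2 ee.
- by exists n; rewrite -pi_jacobson_quotX; apply/pi_jacobson_quot_eq0.
- by rewrite -!piM ej.
Qed.

Lemma jacobson_quot_nil_left_ideal (b : Q) :
  (forall r, nilpotent (r * b)) -> b = 0.
Proof.
have [_ piM] := pi_jacobson_quot_monoid_morphism R.
rewrite -[b]reprK => nil_b; apply/pi_jacobson_quot_eq0.
apply: nil_left_ideal_jacobson => r; have [n rbn0] := nil_b (\pi_Q r).
by exists n; apply/pi_jacobson_quot_eq0; rewrite pi_jacobson_quotX piM.
Qed.

End Quotient.

Theorem proposition2p22 (R : pzRingType) (hR : strongly_Jsharp_clean R) :
  boolean_ring (jacobson_quot R).
Proof.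
have cleanQ := jacobson_quot_strongly_nil_clean hR.
have reducedQ : forall x : jacobson_quot R, nilpotent x -> x = 0.
  apply: sqr0_reduced => b bb; apply: jacobson_quot_nil_left_ideal => r.
  exact: sqr0_mul_nilpotent.
move=> a; have [e [j [-> ee nil_j _]]] := cleanQ a.
by rewrite (reducedQ j nil_j) addr0 expr2.
Qed.
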